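(* Let $\lambda\in\{1,2,3\}$ and let $G$ be a $\lambda$-edge-connected planar graph of order $n\geq 2$ with $G \ncong K_4$. Let $\chi(G^c)$ be the chromatic number of the complement $G^c$ of $G$. Then $$ {}^{\partial}\gamma_{M}(G)\geq \begin{cases} \max \{0,\ n-3\chi(G^c)\}, & \text{if } \lambda=1,\\ \max \{1,\ n-3\chi(G^c)+1\}, & \text{if } \lambda=2,\\ \max \left\{\left\lceil\frac{n}{2}\right\rceil+1,\ n-\left\lfloor \frac{3\chi(G^c)}{2} \right\rfloor+1\right\}, & \text{if } \lambda=3. \end{cases}$$
   Context: All graphs are finite and simple (partial duals, however, may have loops or multiple edges). The order of a graph is its number of vertices; $K_m$ is the complete graph of order $m$. A graph $G$ is $k$-edge-connected if any two distinct vertices $u,v$ of $G$ are joined by $k$ pairwise edge-disjoint $uv$-paths. All embeddings are cellular. A planar graph $G$ is regarded as an embedded graph via an embedding on the sphere. Partial dual: Let $G$ be a graph cellularly embedded on an orientable surface, viewed as a ribbon graph (a thickened neighbourhood of $G$ consisting of vertex discs and edge ribbons), and let $A\subseteq E(G)$. The partial dual $G^A$ of $G$ with respect to $A$ (Chmutov) is the embedded graph (ribbon graph) obtained as follows: glue a disc to $G$ along each boundary component of the spanning ribbon subgraph $(V(G),A)$ (these discs are the vertex discs of $G^A$), and remove the interiors of all vertex discs of $G$; the edge ribbons are kept. In particular $G^{\emptyset}=G$ and $G^{E(G)}=G^*$, the geometric dual. Write $\gamma(G^A)$ for the genus of the (orientable) surface on which $G^A$ is cellularly embedded. Equivalently,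 for $G$ connected, $2-2\gamma(G^A)=f(A)-|E(G)|+f(E(G)\setminus A)$, where $f(B)$ is the number of boundary components of the spanning ribbon subgraph $(V(G),B)$. The maximum partial-dual genus of $G$ is ${}^{\partial}\gamma_M(G):=\max_{A\subseteq E(G)}\gamma(G^A)$. For a connected planar graph $G$ it is known that this value does not depend on the chosen embedding of $G$ on the sphere. *)

(* Defs.v *)
From mathcomp Require Import all_boot all_order all_algebra all_fingroup.

Set Implicit Arguments.
Unset Strict Implicit.
Unset Printing Implicit Defensive.

Record sgraph := SGraph {
  vertex :> finType;
  adj : rel vertex;
  adj_sym : symmetric adj;
  adj_irrefl : irreflexive adj
}.

Definition isomorphic (G H : sgraph) : Prop :=
  exists2 f : G -> H, bijective f & forall x y, adj (f x) (f y) = adj x y.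

Section Complete.
Variable m : nat.
Definition complete_adj : rel 'I_m := fun i j => i != j.
Lemma complete_adj_sym : symmetric complete_adj.
Proof. by move=> i j; rewrite /complete_adj eq_sym. Qed.
Lemma complete_adj_irrefl : irreflexive complete_adj.
Proof. by move=> i; rewrite /complete_adj eqxx. Qed.
Definition complete_graph := SGraph complete_adj_sym complete_adj_irrefl.
End Complete.

Section Complement.
Variable G : sgraph.
Definition compl_adj : rel G := fun x y => (x != y) && ~~ adj x y.
Lemma compl_adj_sym : symmetric compl_adj.
Proof. by move=> x y; rewrite /compl_adj eq_sym adj_sym. Qed.
Lemma compl_adj_irrefl : irreflexive compl_adj.
Proof. by move=> x; rewrite /compl_adj eqxx. Qed.
Definition complement := SGraph compl_adj_sym compl_adj_irrefl.
End Complement.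

Definition colorable (G : sgraph) (k : nat) : bool :=
  [exists c : {ffun G -> 'I_k}, [forall x, forall y, adj x y ==> (c x != c y)]].

Lemma ex_colorable (G : sgraph) : exists k, colorable G k.
Proof.
exists #|G|; apply/existsP; exists [ffun x => enum_rank x].
apply/forallP=> x; apply/forallP=> y; apply/implyP=> xy.
rewrite !ffunE (inj_eq enum_rank_inj).
by apply: contraTneq xy => ->; rewrite adj_irrefl.
Qed.

Definition chromatic_number (G : sgraph) : nat := ex_minn (ex_colorable G).

(* A path from [u] is given by the sequence [p] of its vertices after [u]. *)
Definition is_path (G : sgraph) (u v : G) (p : seq G) : bool :=
  [&& path (@adj G) u p, last u p == v & uniq (u :: p)].

Definition path_edges (G : sgraph) (u : G) (p : seq G) : seq {set G} :=
  pairmap (fun x y => [set x; y]) u p.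

Definition edge_disjoint (G : sgraph) (u : G) : rel (seq G) :=
  fun p q => ~~ has [in path_edges u p] (path_edges u q).

Definition edge_connected (k : nat) (G : sgraph) : Prop :=
  forall u v : G, u != v ->
    exists2 ps : k.-tuple (seq G),
      all (is_path u v) ps & pairwise (edge_disjoint u) ps.

(* An oriented ribbon graph without isolated vertices, as a combinatorial map *)
(* on its half-edges: the vertex discs are the cycles of [rot] (in the order  *)
(* in which half-edges are met along the boundary of the disc), the edge      *)
(* ribbons are the cycles of [flip]. Loops and multiple edges are allowed.    *)
Record ribbon := Ribbon {
  half_edge :> finType;
  rot : {perm half_edge};
  flip : {perm half_edge};
  flipK : involutive flip;
  flip_neq : forall d, flip d != d
}.

Section RibbonTheory.
Variable M : ribbon.

(* [(flip M * rot M) d] is [rot M (flip M d)]: go along the side of the       *)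
(* ribbon of [d], then on to the next half-edge at its other end.             *)
Definition face : {perm M} := (flip M * rot M)%g.

Definition ribbon_vertices : {set {set M}} := porbits (rot M).
Definition ribbon_edges : {set {set M}} := porbits (flip M).
Definition ribbon_faces : {set {set M}} := porbits face.

Definition components : nat :=
  n_comp [rel x y | (y == rot M x) || (y == flip M x)] [pred x : M | true].

(* The Euler characteristic of the closed surface obtained by capping off     *)
(* every boundary component of the ribbon graph with a disc.                  *)
Definition euler_char : int :=
  (#|ribbon_vertices|%:Z - #|ribbon_edges|%:Z + #|ribbon_faces|%:Z)%R.

(* The (total) genus g of that surface: euler_char = 2 * components - 2 * g,  *)
(* where 2 * components - euler_char is always even and nonnegative.          *)
Definition genus : nat := `|(2 * components%:Z - euler_char)%R|%N./2.

Definition spherical : bool := (components == 1) && (euler_char == 2%:Z%R).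

Section PartialDual.
Variable A : {set {set M}}.

Definition flip_in (d : M) : M :=
  if porbit (flip M) d \in A then flip M d else d.

Lemma flip_inK : involutive flip_in.
Proof.
move=> d; rewrite /flip_in; case dA: (porbit _ d \in A); last by rewrite dA.
by rewrite (porbit_perm (flip M) 1 d) dA flipK.
Qed.

(* Tracing a boundary component of the spanning ribbon subgraph with edge set *)
(* A, one runs along the side of the ribbon of [d] when the edge of [d] is in *)
(* A, and passes the end [d] of a removed ribbon otherwise, and then reaches  *)
(* the next half-edge. The cycles of this permutation are the new vertex      *)
(* discs; for an edge in A, the half-edge [d] now stands for the side of the  *)
(* ribbon traversed from [d], which is one of the two new ends of the ribbon. *)
Definition partial_dual_rot : {perm M} := (perm (can_inj flip_inK) * rot M)%g.

Definition partial_dual : ribbon :=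
  @Ribbon M partial_dual_rot (flip M) (@flipK M) (@flip_neq M).

End PartialDual.

Lemma partial_dual_set0 : rot (partial_dual set0) = rot M.
Proof. by apply/permP=> d; rewrite /= !permM permE /flip_in inE. Qed.

Lemma partial_dual_edges : rot (partial_dual ribbon_edges) = face.
Proof.
by apply/permP=> d; rewrite /= /face !permM permE /flip_in imset_f.
Qed.

End RibbonTheory.

Definition max_partial_dual_genus (M : ribbon) : nat :=
  \max_(A in powerset (ribbon_edges M)) genus (partial_dual A).

Section Embedding.
Variable G : sgraph.

Definition dart : finType := {d : G * G | adj d.1 d.2}.

Lemma dart_rev_proof (d : dart) : adj (val d).2 (val d).1.
Proof. by rewrite adj_sym (valP d). Qed.

Definition dart_rev (d : dart) : dart :=
  exist (fun d : G * G => adj d.1 d.2) ((val d).2, (val d).1) (dart_rev_proof d).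

Lemma dart_revK : involutive dart_rev.
Proof. by move=> d; apply: val_inj => /=; rewrite -surjective_pairing. Qed.

Definition dart_flip : {perm dart} := perm (can_inj dart_revK).

Lemma dart_flipK : involutive dart_flip.
Proof. by move=> d; rewrite !permE dart_revK. Qed.

Lemma dart_flip_neq d : dart_flip d != d.
Proof.
rewrite permE; apply/eqP => /(congr1 (fun d : dart => (val d).1)) /= dd.
by have := valP d; rewrite /= dd adj_irrefl.
Qed.

(* A cyclic ordering of the darts leaving each vertex, which describes a      *)
(* cellular embedding of G in an oriented surface when no vertex of G is      *)
(* isolated.                                                                  *)
Definition rotation_system (r : {perm dart}) : Prop :=
  forall d : dart, porbit r d = [set d' : dart | (val d').1 == (val d).1].

Definition embedded (r : {perm dart}) : ribbon :=
  Ribbon r dart_flipK dart_flip_neq.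

Definition sphere_embedding (r : {perm dart}) : Prop :=
  rotation_system r /\ spherical (embedded r).

End Embedding.

(* Main.v *)
Require Import Defs.
From mathcomp Require Import all_boot all_order all_algebra all_fingroup.
From mathcomp Require Import zify.

(** Write [n] for the order of [G], and [k A] for the number of components of
    the spanning subgraph with edge set [A].  The Euler inequality for the
    ribbon subgraphs [A] and [E :\: A], whose boundary components are the
    vertices and the faces of the partial dual, gives
    [genus (G^A) >= 1 + n - k A - k (E :\: A)], so it suffices to split the
    edges into two parts with few components in total.

    How well this can be done is the matroid union theorem for two copies of
    the graphic matroid ([submodular_partition]): some splitting and some set
    of edges [X] satisfy
    [k A + k (E :\: A) <= 2 * k X - #|E :\: X|].  The edges between distinct
    components of [X] all lie outside [X].  Hence, if [p] is the number of
    those components and [D] is the set of ordered pairs of adjacent vertices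
    in distinct components, then
    [2 + 2 * n + #|D| <= 2 * genus + 4 * p] ([max_genus_quotient]).

    It remains to bound [4 * p - #|D|] from above.
    - If [1 < p] then at least [lambda] edges leave each component, so
      [lambda * p <= #|D|] ([leq_card_cross_pairs]); with [p <= n] this gives
      the constant bounds for [lambda] equal to 2 and 3.
    - A colouring of the complement covers [G] by [chi] cliques.  Choose one
      representative in each component: if [j] representatives have the same
      colour, then they are pairwise adjacent, so each of their components is
      joined to [j - 1] others.  Summing over the colours gives
      [4 * p - #|D| <= 6 * chi] ([leq_card_reps6]), and, when [lambda = 3] and
      there are at least two colours, [4 * p - #|D| <= 3 * chi]
      ([leq_card_reps3]).

    A 3-edge-connected graph covered by a single clique is complete of order at
    least 4; order 4 is excluded by hypothesis, and larger orders by planarity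
    ([spherical_complete_order]).

    The number [k A] never appears: the rank [n - k A] is the dimension of the
    span over the field with two elements of the vectors [x + y], for the edges
    [xy] of [A], and two vertices lie in one component exactly when their
    difference is in that span.  Submodularity of the rank is then the
    dimension formula for a sum of two subspaces. *)

Set Implicit Arguments.
Unset Strict Implicit.
Unset Printing Implicit Defensive.

Import GRing.Theory.

(* [rot] alone would denote the rotation of sequences. *)
Local Notation rot := Defs.rot.

(** * Splitting a set between two submodular functions *)

Definition submodular (T : finType) (f : {set T} -> nat) :=
  forall A B : {set T}, f (A :|: B) + f (A :&: B) <= f A + f B.

(** For a rank function this is contraction of [e], without the subtraction of
    the constant [f [set e]]. *)
Lemma submodular_contract (T : finType) (f : {set T} -> nat) e :
  submodular f -> submodular (fun A => f (e |: A)).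
Proof. by move=> sub A B; rewrite setUUr setUIr; apply: sub. Qed.

(** The nontrivial half of the matroid union theorem.  Remove an element [e]
    of [E], once contracting it in [f] and once in [g]; this gives two
    splittings of [E], with dual sets [Y] and [Z].  By submodularity, the
    left-hand sides at [e |: (Y :|: Z)] and at [Y :&: Z] exceed in total those
    of the two contracted problems by at most one; hence one of them does not
    exceed the value of the better splitting. *)
Lemma submodular_partition (T : finType) (f g : {set T} -> nat) (E : {set T}) :
    submodular f -> submodular g ->
  exists A X : {set T}, [/\ A \subset E, X \subset E
    & #|E :\: X| + f X + g X <= f A + g (E :\: A)].
Proof.
move cE: #|E| => n; elim: n => [|n IH] in E cE f g * => subf subg.
  move/eqP: cE; rewrite cards_eq0 => /eqP->.
  by exists set0, set0; rewrite !setD0 sub0set cards0.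
have /card_gt0P[e eE] : 0 < #|E| by rewrite cE.
have cE' : #|E :\ e| = n by move: cE; rewrite (cardsD1 e) eE => -[].
have [A1 [Y [sA1 sY le1]]] := IH _ cE' _ _ (submodular_contract e subf) subg.
have [A2 [Z [sA2 sZ le2]]] := IH _ cE' _ _ subf (submodular_contract e subg).
have sE (B : {set T}) : B \subset E :\ e -> (B \subset E) /\ (e \notin B).
  by rewrite subsetD1 => /andP[].
have [[sA1E _] [sA2E eA2]] := (sE _ sA1, sE _ sA2).
have [[sYE eY] [sZE eZ]] := (sE _ sY, sE _ sZ).
have D1 : (E :\ e) :\: A1 = E :\: (e |: A1) by rewrite setDDl.
have D2 : e |: ((E :\ e) :\: A2) = E :\: A2.
  apply/setP=> x; rewrite !inE; case: (eqVneq x e) => //= ->.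
  by rewrite eA2 eE.
rewrite {}D1 in le1; rewrite {}D2 in le2.
have sA1' : e |: A1 \subset E by rewrite subUset sub1set eE.
have [B [sB le1B le2B]] : exists B : {set T}, [/\ B \subset E,
    f (e |: A1) + g (E :\: (e |: A1)) <= f B + g (E :\: B)
    & f A2 + g (E :\: A2) <= f B + g (E :\: B)].
  case: (leqP (f (e |: A1) + g (E :\: (e |: A1))) (f A2 + g (E :\: A2))).
    by exists A2.
  by move/ltnW; exists (e |: A1).
have subf_YZ := subf (e |: Y) Z; have subg_YZ := subg (e |: Z) Y.
have U1 : (e |: Y) :|: Z = e |: (Y :|: Z) by rewrite setUA.
have U2 : (e |: Z) :|: Y = e |: (Y :|: Z) by rewrite -setUA [Z :|: Y]setUC.
have I1 : (e |: Y) :&: Z = Y :&: Z.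
  apply/setP=> x; rewrite !inE; case: (eqVneq x e) => //= ->.
  by rewrite (negPf eZ) andbF.
have I2 : (e |: Z) :&: Y = Y :&: Z.
  apply/setP=> x; rewrite !inE [_ && (x \in Z)]andbC.
  by case: (eqVneq x e) => //= ->; rewrite (negPf eY) andbF.
rewrite {}U1 {}I1 in subf_YZ; rewrite {}U2 {}I2 in subg_YZ.
have sU : e |: (Y :|: Z) \subset E by rewrite subUset sub1set eE subUset sYE.
have sI : Y :&: Z \subset E by apply: subset_trans sYE; apply: subsetIl.
have [le|gt] := leqP (#|E :\: (e |: (Y :|: Z))| + f (e |: (Y :|: Z))
    + g (e |: (Y :|: Z))) (f B + g (E :\: B)).
  by exists B, (e |: (Y :|: Z)).
exists B, (Y :&: Z); split=> //.
have card_co (F X : {set T}) : X \subset F -> #|F :\: X| + #|X| = #|F|.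
  by move=> /setIidPr sX; rewrite -(cardsID X F) sX addnC.
have := card_co _ _ sU; have := card_co _ _ sI.
have := card_co _ _ sY; have := card_co _ _ sZ.
rewrite cE cE' cardsU1 inE (negPf eY) (negPf eZ) /=.
move: (cardsUI Y Z) subf_YZ subg_YZ gt le1 le2 le1B le2B; clear.
move: #|Y :|: Z| #|Y :&: Z| #|_ :\: (Y :&: Z)| #|_ :\: (_ |: _)|.
move: #|_ :\: Y| #|_ :\: Z| #|Y| #|Z| => *.
lia.
Qed.

(** * The graphic matroid of a ribbon graph, over the field with two elements *)

Section GraphicRank.
Variables (M : ribbon) (V : finType) (end_of : M -> V).
Local Open Scope ring_scope.

Definition vertex_vec (x : V) : 'rV['F_2]_#|V| := 'e_(enum_rank x).

(** In characteristic 2 this is the difference of the ends of [e], with no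
    choice of an orientation; see [edge_vec_porbit]. *)
Definition edge_vec (e : {set M}) := \sum_(d in e) vertex_vec (end_of d).

Definition edge_span (A : {set {set M}}) : {vspace 'rV['F_2]_#|V|} :=
  (\sum_(e in A) <[edge_vec e]>)%VS.

Definition edge_rank (A : {set {set M}}) : nat := \dim (edge_span A).

Definition linked (A : {set {set M}}) : rel V :=
  fun x y => vertex_vec x - vertex_vec y \in edge_span A.

Lemma edge_spanU A B : edge_span (A :|: B) = (edge_span A + edge_span B)%VS.
Proof.
apply/eqP; rewrite eqEsubv subv_add; apply/and3P; split.
- apply/subv_sumP=> e; rewrite inE => /orP[] eAB.
    by apply: subv_trans (addvSl _ _); apply: (sumv_sup e).
  by apply: subv_trans (addvSr _ _); apply: (sumv_sup e).
- by apply/subv_sumP=> e eA; apply: (sumv_sup e); rewrite ?inE ?eA.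
- by apply/subv_sumP=> e eB; apply: (sumv_sup e); rewrite ?inE ?eB ?orbT.
Qed.

Lemma edge_spanS (A B : {set {set M}}) :
  A \subset B -> (edge_span A <= edge_span B)%VS.
Proof. by move=> /setUidPr <-; rewrite edge_spanU addvSl. Qed.

Lemma edge_rank_submodular : submodular edge_rank.
Proof.
move=> A B; rewrite /edge_rank edge_spanU.
rewrite -(dimv_sum_cap (edge_span A)) leq_add2l.
by apply: dimvS; rewrite subv_cap !edge_spanS ?subsetIl ?subsetIr.
Qed.

Lemma edge_rank0 : edge_rank set0 = 0%N.
Proof. by rewrite /edge_rank /edge_span big_set0 dimv0. Qed.

Lemma edge_span1 e : edge_span [set e] = <[edge_vec e]>%VS.
Proof. by rewrite /edge_span big_set1. Qed.

Lemma edge_rankU1 e A : (edge_rank (e |: A) <= (edge_rank A).+1)%N.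
Proof.
rewrite /edge_rank edge_spanU edge_span1.
apply: leq_trans (dimv_add_leqif _ _) _.
by rewrite dim_vline; apply: (leq_add (leq_b1 _) (leqnn _)).
Qed.

Lemma linked_refl A : reflexive (linked A).
Proof. by move=> x; rewrite /linked subrr mem0v. Qed.

Lemma linked_sym A : symmetric (linked A).
Proof. by move=> x y; rewrite /linked -opprB rpredN. Qed.

Lemma linked_trans A : transitive (linked A).
Proof.
by move=> y x z xy yz; rewrite /linked -(subrKA (vertex_vec y)) rpredD.
Qed.

Lemma porbit_flip d : porbit (flip M) d = [set d; flip M d].
Proof.
apply/setP=> x; rewrite in_set2; apply/porbitP/orP=> [[i ->]|[]/eqP->].
- rewrite permX; elim: i => [|i [/eqP|/eqP]] /=; first by left.
    by move=> ->; right.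
  by move=> ->; rewrite flipK; left.
- by exists 0%N; rewrite expg0 perm1.
- by exists 1%N; rewrite expg1.
Qed.

Lemma edge_vec_porbit d :
  edge_vec (porbit (flip M) d)
    = vertex_vec (end_of d) - vertex_vec (end_of (flip M d)).
Proof.
rewrite /edge_vec porbit_flip big_setU1 ?big_set1; last first.
  by rewrite inE eq_sym flip_neq.
congr (_ + _); set u := vertex_vec _.
by rewrite -scaleN1r [- 1](_ : _ = 1) ?scale1r //; apply/val_inj.
Qed.

Lemma linked_edge (A : {set {set M}}) d :
  porbit (flip M) d \in A -> linked A (end_of d) (end_of (flip M d)).
Proof.
move=> dA; rewrite /linked -edge_vec_porbit.
have sA : [set porbit (flip M) d] \subset A by rewrite sub1set.
by apply: (subvP (edge_spanS sA)); rewrite edge_span1 memv_line.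
Qed.

Lemma edge_rankU1_linked A d :
  linked A (end_of d) (end_of (flip M d)) ->
  edge_rank (porbit (flip M) d |: A) = edge_rank A.
Proof.
move=> dA; rewrite /edge_rank edge_spanU edge_span1 edge_vec_porbit.
by rewrite (addv_idPr _) // -memvE.
Qed.

(** The choice of [pick] depends on the class [linked A x] alone, so this is a
    canonical representative of the component of [x]. *)
Definition linked_root A x := odflt x [pick y | linked A x y].

Lemma linked_rootP A x : linked A x (linked_root A x).
Proof.
by rewrite /linked_root; case: pickP => //= /(_ x); rewrite linked_refl.
Qed.

Lemma linked_root_eq A x y :
  (linked_root A x == linked_root A y) = linked A x y.
Proof.
apply/eqP/idP=> [xy|xy].
  apply: linked_trans (linked_rootP A x) _; rewrite xy linked_sym.
  exact: linked_rootP.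
rewrite /linked_root; rewrite (@eq_pick _ _ (linked A y)); last first.
  by move=> z; apply/idP/idP; apply: linked_trans; rewrite // linked_sym.
by case: pickP => //= /(_ y); rewrite linked_refl.
Qed.

(** The vectors of the representatives span the whole space modulo
    [edge_span A], since each vertex is congruent to its representative. *)
Lemma leq_card_edge_rank A :
  (#|V| <= edge_rank A + #|[set linked_root A x | x in V]|)%N.
Proof.
set R := [set _ | x in V].
pose U := <<[seq vertex_vec x | x <- enum R]>>%VS.
have dU : (\dim U <= #|R|)%N.
  by apply: leq_trans (dim_span _) _; rewrite size_map -cardE.
have full : (fullv <= edge_span A + U)%VS.
  apply/subvP=> u _; rewrite (row_sum_delta u).
  apply: rpred_sum => i _; apply: rpredZ.
  rewrite -[i]enum_valK -/(vertex_vec _).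
  rewrite -[vertex_vec _](subrK (vertex_vec (linked_root A (enum_val i)))).
  apply: memv_add; first exact: linked_rootP.
  by apply: memv_span; apply: map_f; rewrite mem_enum imset_f.
have /dimvS := full; rewrite dimvf dim_matrix mul1r => le.
apply: leq_trans le _; apply: leq_trans (dimv_add_leqif _ _) _.
by rewrite leq_add2l.
Qed.

End GraphicRank.

(** * The genus of a partial dual *)

(** Each step can be undone, because iterating a permutation of a finite type
    leads back to the starting point. *)
Lemma connect_perm_sym (T : finType) (p q : {perm T}) :
  connect_sym [rel x y | (y == p x) || (y == q x)].
Proof.
set e := rel_of_simpl _.
have back x y : e x y -> connect e y x.
  have sub (f : {perm T}) : subrel (frel f) e -> connect e (f x) x.
    move=> fe; apply: (connect_sub (e := frel f)).
      by move=> u v /fe; apply: connect1.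
    by rewrite (fconnect_sym perm_inj) fconnect1.
  by case/orP=> /eqP->; apply: sub => u v /eqP<-; rewrite /e /= eqxx ?orbT.
suff half x y : connect e x y -> connect e y x.
  by move=> x y; apply/idP/idP; apply: half.
case/connectP=> s; elim: s x => [|z s IH] x /= => [_ ->//|/andP[xz zs] ylast].
exact: connect_trans (IH z zs ylast) (back _ _ xz).
Qed.

Lemma components_gt0 (M : ribbon) (d : M) : 0 < components M.
Proof.
rewrite /components /n_comp_mem; apply/card_gt0P.
set e := rel_of_simpl _.
exists (fingraph.root e d); rewrite !inE andbT.
exact/fingraph.roots_root/connect_perm_sym.
Qed.

Section PartialDualGenus.
Variables (M : ribbon) (V : finType) (end_of : M -> V).
Hypothesis end_rot : forall d, end_of (rot M d) = end_of d.
Hypothesis card_rot : #|ribbon_vertices M| <= #|V|.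

Local Notation edge d := (porbit (flip M) d).
Local Notation rk := (edge_rank end_of).

Lemma edge_flip (d : M) : edge (flip M d) = edge d.
Proof. exact: (porbit_perm (flip M) 1 d). Qed.

Lemma edgeP e : e \in ribbon_edges M -> exists d : M, e = edge d.
Proof. by case/imsetP=> d _ ->; exists d. Qed.

(** A boundary component of the spanning ribbon subgraph stays in one
    connected component of it. *)
Lemma porbit_partial_dual_linked (A : {set {set M}}) (d d' : M) :
  d' \in porbit (partial_dual_rot A) d ->
  linked end_of A (end_of d) (end_of d').
Proof.
case/porbitP=> i ->{d'}; rewrite permX; elim: i => [|i IH] /=.
  exact: linked_refl.
apply: linked_trans IH _; set x := iter _ _ _.
rewrite permM permE end_rot /flip_in; case: ifP => [xA|_].
  exact: linked_edge.
exact: linked_refl.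
Qed.

Lemma partial_dual_rotU1 (A : {set {set M}}) (d : M) : edge d \notin A ->
  partial_dual_rot (edge d |: A)
    = (tperm d (flip M d) * partial_dual_rot A)%g.
Proof.
move=> dA; apply/permP=> x; rewrite !permM; congr (rot M _); rewrite !permE.
have edge_neq : (x != d) && (x != flip M d) = (edge x != edge d).
  by rewrite eq_porbit_mem porbit_flip in_set2 negb_or.
rewrite /flip_in in_setU1 /=; case: (eqVneq x d) => [->|xd].
  by rewrite eqxx edge_flip (negPf dA).
case: (eqVneq x (flip M d)) => [->|xd'].
  by rewrite edge_flip eqxx (negPf dA) flipK.
by move: edge_neq; rewrite xd xd' => /esym/negPf->.
Qed.

(** Euler's inequality for the ribbon subgraph [A], by adding the edges one at
    a time.  A new edge multiplies the boundary permutation by a transposition.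
    If this splits a cycle, then the ends of the edge were already linked and
    the rank stays the same; otherwise two cycles merge, and the rank grows by
    at most one. *)
Lemma card_partial_dual_vertices (A : {set {set M}}) :
    A \subset ribbon_edges M ->
  #|ribbon_vertices (partial_dual A)| + 2 * rk A <= #|V| + #|A|.
Proof.
rewrite /ribbon_vertices /=.
move cA: #|A| => m; elim: m => [|m IH] in A cA * => sA.
  move/eqP: cA; rewrite cards_eq0 => /eqP->.
  rewrite edge_rank0 -[partial_dual_rot _]/(rot (partial_dual set0)).
  by rewrite partial_dual_set0 muln0 !addn0.
have /card_gt0P[e eA] : 0 < #|A| by rewrite cA.
have [d ed] := edgeP (subsetP sA _ eA); rewrite {}ed in eA.
have cA' : #|A :\ edge d| = m by move: cA; rewrite (cardsD1 (edge d)) eA => -[].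
have dA : edge d \notin A :\ edge d by rewrite !inE eqxx.
have le := IH _ cA' (subset_trans (subsetDl _ _) sA).
rewrite -(setD1K eA); move: (A :\ edge d) dA le => B dB le.
rewrite (partial_dual_rotU1 dB).
have /= := porbits_mul_tperm (partial_dual_rot B) d (flip M d).
rewrite [d == _]eq_sym flip_neq addn1 porbit_sym.
case: (boolP (flip M d \in _)) => [dd|_] /=.
  rewrite (edge_rankU1_linked (porbit_partial_dual_linked dd)).
  rewrite double0 addn0 => ->.
  by rewrite addSn addnS ltnS.
move: le (edge_rankU1 end_of (edge d) B); clear.
rewrite -mul2n.
move: (rk _) (rk _) #|porbits _| #|porbits _| #|V| => *.
lia.
Qed.

(** The faces of the partial dual are the boundary components of the
    complementary ribbon subgraph. *)
Lemma face_partial_dual (A : {set {set M}}) :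
  face (partial_dual A) = partial_dual_rot (ribbon_edges M :\: A).
Proof.
apply/permP=> d; rewrite /face /= !permM; congr (rot M _); rewrite !permE.
by rewrite /flip_in edge_flip inE imset_f // andbT flipK; case: (_ \in A).
Qed.

Lemma genus_partial_dual (A : {set {set M}}) (d0 : M) :
    A \subset ribbon_edges M ->
  1 + rk A + rk (ribbon_edges M :\: A) <= #|V| + genus (partial_dual A).
Proof.
move=> sA; have fA := card_partial_dual_vertices sA.
have fAc := card_partial_dual_vertices (subsetDl (ribbon_edges M) A).
have cE : #|ribbon_edges M :\: A| + #|A| = #|ribbon_edges M|.
  by rewrite -(cardsID A (ribbon_edges M)) (setIidPr sA) addnC.
have comp_gt0 := @components_gt0 (partial_dual A) d0.
have cF : #|ribbon_faces (partial_dual A)|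
    = #|ribbon_vertices (partial_dual (ribbon_edges M :\: A))|.
  by rewrite /ribbon_faces face_partial_dual.
have cE' : #|ribbon_edges (partial_dual A)| = #|ribbon_edges M| by [].
rewrite /genus /euler_char cF cE'.
move: fA fAc cE comp_gt0.
move: (components _) #|ribbon_vertices _| #|ribbon_vertices _|.
move: #|ribbon_edges M| #|A| #|_ :\: _| (rk _) (rk _) #|V| => *.
lia.
Qed.

End PartialDualGenus.

(** * Edges crossing a cut *)

Lemma path_crosses (G : sgraph) (C : {set G}) u p :
    path (@adj G) u p -> u \in C -> last u p \notin C ->
  exists xy : G * G, [/\ adj xy.1 xy.2, xy.1 \in C, xy.2 \notin C
    & [set xy.1; xy.2] \in path_edges u p].
Proof.
elim: p u => [|v p IH] u /= => [_ ->//|/andP[uv vp] uC lC].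
have [vC|vC] := boolP (v \in C); last by exists (u, v); rewrite mem_head.
have [xy [? ? ? xyp]] := IH v vp vC lC.
by exists xy; split; rewrite // inE xyp orbT.
Qed.

(** Each of the edge-disjoint paths from [u] to [v] crosses the cut, and the
    crossing edges are distinct. *)
Lemma edge_connected_cut lambda (G : sgraph) (C : {set G}) u v :
    edge_connected lambda G -> u \in C -> v \notin C ->
  lambda <= #|[set xy : G * G
                | [&& adj xy.1 xy.2, xy.1 \in C & xy.2 \notin C]]|.
Proof.
move=> conn uC vC; have uv : u != v by apply: contraNneq vC => <-.
have [ps /allP is_ps disj] := conn u v uv.
have cross (i : 'I_lambda) : exists xy : G * G,
    [/\ adj xy.1 xy.2, xy.1 \in C, xy.2 \notin C
      & [set xy.1; xy.2] \in path_edges u (tnth ps i)].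
  have /and3P[pi /eqP li _] := is_ps _ (mem_tnth i ps).
  by apply: path_crosses; rewrite ?li.
have [f fP] := fin_all_exists cross.
have f_neq (i j : 'I_lambda) : i < j -> f i != f j.
  move=> ij; apply/eqP=> fij.
  have [_ _ _ ei] := fP i; have [_ _ _ ej] := fP j.
  have := pairwiseP [::] disj i j.
  rewrite !inE !size_tuple !ltn_ord => /(_ isT isT ij).
  rewrite -!tnth_nth => /hasPn/(_ _ ej)/negP; apply.
  by rewrite /= -fij.
have f_inj : injective f.
  move=> i j fij; apply/val_inj; case: (ltngtP i j) => // /f_neq.
    by rewrite fij eqxx.
  by rewrite fij eqxx.
rewrite -[X in X <= _]card_ord -(card_codom f_inj); apply: subset_leq_card.
by apply/subsetP=> _ /codomP[i ->]; have [a b c _] := fP i; rewrite inE a b c.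
Qed.

(** * Counting the edges between the classes of a partition *)

(** The classes are the fibres of [rho], which maps each vertex to the
    representative of its class. *)
Section Quotient.
Variables (G : sgraph) (rho : G -> G).
Hypothesis rhoK : forall x, rho (rho x) = rho x.

Definition reps : {set G} := [set rho x | x in G].

Definition out_pairs r : {set G * G} :=
  [set xy | [&& adj xy.1 xy.2, rho xy.1 == r & rho xy.2 != r]].

Definition cross_pairs : {set G * G} :=
  [set xy | adj xy.1 xy.2 && (rho xy.1 != rho xy.2)].

Lemma rho_reps x : rho x \in reps.
Proof. exact: imset_f. Qed.

Lemma repsK r : r \in reps -> rho r = r.
Proof. by case/imsetP=> x _ ->. Qed.

Lemma card_cross_pairs : #|cross_pairs| = \sum_(r in reps) #|out_pairs r|.
Proof.
rewrite -sum1_card (partition_big (fun xy => rho xy.1) (mem reps)); last first.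
  by move=> xy _; apply: rho_reps.
apply: eq_bigr => r _; rewrite -sum1_card; apply: eq_bigl => xy.
rewrite !inE -andbA; case: (eqVneq (rho xy.1) r) => [->|_].
  by rewrite andbT eq_sym.
by rewrite !andbF.
Qed.

Lemma leq_card_out_pairs lambda r : edge_connected lambda G -> 1 < #|reps| ->
  r \in reps -> lambda <= #|out_pairs r|.
Proof.
move=> conn reps_gt1 rR.
have /card_gt0P[s] : 0 < #|reps :\ r| by move: reps_gt1; rewrite (cardsD1 r) rR.
rewrite !inE => /andP[sr sR].
have := @edge_connected_cut _ _ [set x | rho x == r] r s conn.
rewrite !inE !repsK // eqxx => /(_ isT sr) le; apply: leq_trans le _.
by apply: subset_leq_card; apply/subsetP=> xy; rewrite !inE.
Qed.

Lemma leq_card_cross_pairs lambda : edge_connected lambda G -> 1 < #|reps| ->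
  lambda * #|reps| <= #|cross_pairs|.
Proof.
move=> conn reps_gt1; rewrite card_cross_pairs mulnC -sum_nat_const.
by apply: leq_sum => r rR; apply: leq_card_out_pairs.
Qed.

Section Coloring.
Variables (k : nat) (c : G -> 'I_k).
Hypothesis c_clique : forall x y, x != y -> c x = c y -> adj x y.

Definition color_reps i := [set r in reps | c r == i].

Lemma sum_color_reps (F : G -> nat) :
  \sum_(r in reps) F r = \sum_i \sum_(r in color_reps i) F r.
Proof.
rewrite (partition_big c predT) //; apply: eq_bigr => i _.
by apply: eq_bigl => r; rewrite inE.
Qed.

(** Representatives of the same colour are adjacent, so the class of [r] sends
    an edge to each of them. *)
Lemma clique_out_pairs r : r \in reps ->
  [set (r, s) | s in color_reps (c r) :\ r] \subset out_pairs r.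
Proof.
move=> rR; apply/subsetP=> _ /imsetP[s sQ ->]; move: sQ; rewrite !inE /=.
case/and3P=> sr sR /eqP cs; rewrite !repsK // eqxx sr !andbT.
by apply: c_clique; rewrite // eq_sym.
Qed.

Lemma card_clique_pairs r : r \in reps ->
  (#|[set (r, s) | s in color_reps (c r) :\ r]|).+1 = #|color_reps (c r)|.
Proof.
move=> rR; rewrite card_imset; last by move=> s t [].
by rewrite [RHS](cardsD1 r) inE rR eqxx.
Qed.

Lemma leq_color_reps i r :
  r \in color_reps i -> #|color_reps i| <= #|out_pairs r|.+1.
Proof.
rewrite inE => /andP[rR /eqP<-]; rewrite -(card_clique_pairs rR) ltnS.
exact/subset_leq_card/clique_out_pairs.
Qed.

(** Unless all representatives have colour [i], some edge leaves the union of
    the classes whose representatives do; it is not among the edges between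
    these representatives, which improves [leq_color_reps] by one. *)
Lemma ltn_color_reps i : edge_connected 1 G -> color_reps i != set0 ->
  color_reps i != reps ->
  exists2 r, r \in color_reps i & #|color_reps i| <= #|out_pairs r|.
Proof.
move=> conn /set0Pn[q qi] neq.
have /subsetPn[s sR si] : ~~ (reps \subset color_reps i).
  apply: contraNN neq => sub; rewrite eqEsubset sub andbT.
  by apply/subsetP=> x; rewrite inE => /andP[].
have qR : q \in reps by move: qi; rewrite inE => /andP[].
pose C := [set x | rho x \in color_reps i].
have qC : q \in C by rewrite inE repsK.
have sC : s \notin C by rewrite inE repsK.
have /card_gt0P[[x y]] := edge_connected_cut conn qC sC.
rewrite inE /= => /and3P[xy]; rewrite !inE => /andP[xR /eqP xi] yi.
exists (rho x); first by rewrite inE xR xi eqxx.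
have -> : color_reps i = color_reps (c (rho x)) by rewrite xi.
rewrite -(card_clique_pairs xR).
apply: proper_card; apply/properP; split; first exact: clique_out_pairs.
exists (x, y).
  rewrite inE /= xy eqxx /=; apply: contraNneq yi => ->.
  by rewrite xR xi eqxx.
apply/imsetP=> -[t]; rewrite !inE => /and3P[_ tR tx] [_ yt].
by rewrite yt repsK // tR -xi tx in yi.
Qed.

Lemma leq_sum_out_pairs i : #|color_reps i| * #|color_reps i|.-1
  <= \sum_(r in color_reps i) #|out_pairs r|.
Proof.
rewrite -sum_nat_const; apply: leq_sum => r ri.
by have := leq_color_reps ri; case: #|color_reps i|.
Qed.

Lemma leq_card_reps_color b :
    (forall i, 4 * #|color_reps i|
       <= \sum_(r in color_reps i) #|out_pairs r| + b) ->
  4 * #|reps| <= #|cross_pairs| + b * k.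
Proof.
move=> le; rewrite card_cross_pairs mulnC -sum_nat_const !sum_color_reps.
have -> : b * k = \sum_(i : 'I_k) b by rewrite sum_nat_const card_ord mulnC.
rewrite -big_split; apply: leq_sum => i _.
by rewrite sum_nat_const mulnC; apply: le.
Qed.

(** The constant is the maximum of [4 * j - j * (j - 1)], attained when a
    colour has 2 or 3 representatives. *)
Lemma leq_card_reps6 : 4 * #|reps| <= #|cross_pairs| + 6 * k.
Proof.
apply: leq_card_reps_color => i; have := leq_sum_out_pairs i.
move: #|color_reps i| (\sum_(r in _) _) => j s; clear.
by case: j => [|[|[|[|j]]]] /=; nia.
Qed.

(** With at least [max 3 (j - 1)] edges leaving each class, a colour with [j]
    representatives contributes at most 3 to the difference of the two sides,
    except when [j = 4]: then it may contribute 4.  In that case either an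
    additional edge leaves one of the four classes, or these are all the
    classes, and 4 is at most [3 * k] because there are at least two colours. *)
Lemma leq_card_reps3 : edge_connected 3 G -> 1 < k ->
  4 * #|reps| <= #|cross_pairs| + 3 * k.
Proof.
move=> conn k_gt1.
have conn1 : edge_connected 1 G.
  move=> u v /conn[ps ps_path _]; exists [tuple thead ps].
    by rewrite /= andbT (allP ps_path) // mem_tnth.
  by [].
have [|reps_gt1] := leqP #|reps| 1; first by lia.
have [/existsP[i /andP[/eqP iR /eqP i4]]|] :=
    boolP [exists i, (color_reps i == reps) && (#|color_reps i| == 4)].
  have := leq_card_cross_pairs conn reps_gt1.
  by rewrite -iR i4; lia.
rewrite negb_exists => /forallP not4.
apply: leq_card_reps_color => i; have := not4 i; have := leq_sum_out_pairs i.
have out3 r : r \in color_reps i -> 3 <= #|out_pairs r|.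
  by rewrite inE => /andP[rR _]; apply: leq_card_out_pairs.
have sum3 : 3 * #|color_reps i| <= \sum_(r in color_reps i) #|out_pairs r|.
  by rewrite mulnC -sum_nat_const; apply: leq_sum.
have [i4|i4] := eqVneq #|color_reps i| 4; last first.
  move: i4 sum3; move: #|color_reps i| (\sum_(r in _) _) => j s; clear.
  by case: j => [|[|[|[|j]]]] /=; nia.
rewrite andbT => _ iR.
have [|q qi] := ltn_color_reps conn1 _ iR; first by rewrite -card_gt0 i4.
rewrite i4 (bigD1 q) //= => out4.
have sum9 : 3 * 3 <= \sum_(r in color_reps i | r != q) #|out_pairs r|.
  have -> : 3 * 3 = \sum_(r in color_reps i :\ q) 3.
    by rewrite sum_nat_const; move: i4; rewrite (cardsD1 q) qi add1n => -[->].
  rewrite [leqRHS](eq_bigl (fun r => r \in color_reps i :\ q)); last first.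
    by move=> r; rewrite !inE andbC.
  by apply: leq_sum => r; rewrite 2!inE => /andP[_ ri]; apply: out3.
exact: (leq_add (leq_add out4 sum9) (leqnn 3)).
Qed.

End Coloring.
End Quotient.

(** * Graphs embedded in the sphere *)

Section EmbeddedGraph.
Variables (G : sgraph) (r : {perm dart G}).
Hypothesis rotr : rotation_system r.

Definition tail (d : embedded r) : G := (val (d : dart G)).1.

Lemma tail_rot (d : embedded r) : tail (rot (embedded r) d) = tail d.
Proof.
have : r d \in porbit r d by rewrite (mem_porbit r 1 d).
by rewrite rotr inE => /eqP.
Qed.

Lemma leq_card_vertices : #|ribbon_vertices (embedded r)| <= #|G|.
Proof.
apply: leq_trans (leq_imset_card (fun v => [set d | tail d == v]) G).
apply: subset_leq_card; apply/subsetP=> _ /imsetP[d _ ->].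
by rewrite /= rotr; apply: imset_f.
Qed.

Lemma leq_genus_max (A : {set {set embedded r}}) :
  A \subset ribbon_edges (embedded r) ->
  genus (partial_dual A) <= max_partial_dual_genus (embedded r).
Proof.
by move=> sA; apply: (bigmax_sup A); rewrite ?powersetE.
Qed.

Lemma card_edge (e : {set embedded r}) :
  e \in ribbon_edges (embedded r) -> #|e| = 2.
Proof.
by case/imsetP=> d _ ->; rewrite porbit_flip cards2 eq_sym flip_neq.
Qed.

(** The partition [rho] consists of the components of the dual set [X] in the
    matroid union theorem; an edge between two of them is not in [X], and is
    counted in both directions by [cross_pairs]. *)
Lemma max_genus_quotient (d0 : dart G) : exists2 rho : G -> G,
    forall x, rho (rho x) = rho x
  & 2 + 2 * #|G| + #|cross_pairs rho|
      <= 2 * max_partial_dual_genus (embedded r) + 4 * #|reps rho|.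
Proof.
have sub := edge_rank_submodular tail.
have [A [X [sA sX le]]] :=
  submodular_partition (ribbon_edges (embedded r)) sub sub.
exists (linked_root tail X) => [x|].
  by apply/eqP; rewrite linked_root_eq linked_sym; apply: linked_rootP.
have gA := genus_partial_dual tail_rot leq_card_vertices (d0 : embedded r) sA.
have leg := leq_genus_max sA; have rkX := leq_card_edge_rank tail X.
have cross : #|cross_pairs (linked_root tail X)|
    <= 2 * #|ribbon_edges (embedded r) :\: X|.
  set D := cover (ribbon_edges (embedded r) :\: X).
  apply: (@leq_trans #|[set val d | d in D]|); last first.
    apply: leq_trans (leq_imset_card _ _) _.
    apply: leq_trans (leq_card_cover _) _; rewrite mulnC -sum_nat_const.
    apply: leq_sum => e; rewrite inE => /andP[_ eE].
    by rewrite card_edge.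
  apply: subset_leq_card; apply/subsetP=> xy; rewrite inE => /andP[adj_xy].
  rewrite linked_root_eq => nlink.
  pose d : embedded r := exist (fun d : G * G => adj d.1 d.2) xy adj_xy.
  apply/imsetP; exists d => //.
  apply/bigcupP; exists (porbit (flip (embedded r)) d).
    rewrite inE imset_f // andbT; apply: contra nlink => /(linked_edge tail).
    by rewrite /tail /= permE.
  exact: porbit_id.
move: le gA leg rkX cross; rewrite /reps.
set p := #|[set _ | _ in _]|.
move: #|_ :\: _| #|cross_pairs _| p (genus _) (max_partial_dual_genus _) #|G|.
move: (edge_rank _ _) (edge_rank _ _) (edge_rank _ _).
clear; lia.
Qed.

Lemma sum_card_porbits (T : finType) (s : {perm T}) :
  \sum_(P in porbits s) #|P| = #|T|.
Proof.
rewrite -sum1_card (partition_big (porbit s) (mem (porbits s))); last first.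
  by move=> x _; apply: imset_f.
apply: eq_bigr => _ /imsetP[x _ ->]; rewrite -sum1_card; apply: eq_bigl => y.
by rewrite eq_porbit_mem.
Qed.

Lemma card_porbit_ge3 (T : finType) (s : {perm T}) x :
  s x != x -> s (s x) != x -> 2 < #|porbit s x|.
Proof.
move=> sx ssx.
have sub : [set x; s x; s (s x)] \subset porbit s x.
  apply/subsetP=> y; rewrite !inE -orbA => /or3P[]/eqP->.
  - exact: porbit_id.
  - exact: (mem_porbit s 1).
  - by have := mem_porbit s 2 x; rewrite permX.
apply: leq_trans (subset_leq_card sub).
rewrite -setUA cardsU1 cards2 !inE negb_or ![x == _]eq_sym sx ssx.
by rewrite (inj_eq perm_inj) eq_sym sx.
Qed.

Lemma card_dart_edges : #|dart G| = 2 * #|ribbon_edges (embedded r)|.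
Proof.
rewrite -(sum_card_porbits (flip (embedded r))) mulnC -sum_nat_const.
by apply: eq_bigr => e eE; apply: card_edge.
Qed.

(** Every face has length at least 3: a face of length 1 would be a loop, and
    one of length 2 would be an edge whose end has degree 1.  Euler's formula
    then bounds the number of edges by [3 * #|G| - 6]. *)
Lemma spherical_card_dart : spherical (embedded r) ->
    (forall d : embedded r,
       exists2 d' : embedded r, d' != d & tail d' = tail d) ->
  #|dart G| + 12 <= 6 * #|G|.
Proof.
move=> /andP[_ /eqP euler] deg2.
have faces3 : 3 * #|ribbon_faces (embedded r)| <= #|dart G|.
  rewrite -(sum_card_porbits (face (embedded r))) mulnC -sum_nat_const.
  apply: leq_sum => _ /imsetP[d _ ->].
  set M := embedded r in d *; have faceE (x : M) : face M x = rot M (flip M x).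
    by rewrite permM.
  have tail_flip (x : M) : tail (flip M x) = (val (x : dart G)).2.
    by rewrite /tail /= permE.
  have tail_face (x : M) : tail (face M x) = (val (x : dart G)).2.
    by rewrite faceE tail_rot tail_flip.
  apply: card_porbit_ge3.
    apply/eqP=> /(congr1 tail); rewrite tail_face /tail => eq_ends.
    by have := valP (d : dart G); rewrite /= eq_ends adj_irrefl.
  apply/eqP=> ffd.
  have fd : face M d = flip M d.
    have := congr1 tail ffd; rewrite tail_face => hd.
    have flipE : val (flip M d : dart G)
        = ((val (d : dart G)).2, (val (d : dart G)).1).
      by rewrite /= permE.
    apply: val_inj; rewrite flipE; move: hd (tail_face d); rewrite /tail.
    by case: (val (face M d : dart G)) => u v /= -> ->.
  (* The rotation fixes [flip M d], whose tail then has no other dart. *)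
  have rd : r (flip M d) = flip M d by rewrite -[RHS]fd faceE.
  have [d' d'_neq d'_tail] := deg2 (flip M d).
  have : (d' : dart G) \in porbit r (flip M d) by rewrite rotr inE; apply/eqP.
  case/porbitP=> i d'E; case/eqP: d'_neq; rewrite d'E.
  by rewrite permX; elim: i {d'E} => //= i ->.
have edges2 := card_dart_edges; have vertices := leq_card_vertices.
move: euler faces3 edges2 vertices; rewrite /euler_char.
move: #|ribbon_vertices _| #|ribbon_edges _| #|ribbon_faces _| #|dart G| #|G|.
clear; lia.
Qed.

Lemma spherical_complete_order : (forall x y : G, x != y -> adj x y) ->
  spherical (embedded r) -> 3 <= #|G| -> #|G| <= 4.
Proof.
move=> complete sph n_ge3.
have deg2 (d : embedded r) :
    exists2 d' : embedded r, d' != d & tail d' = tail d.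
  case: d => -[x y] /= xy.
  have /card_gt0P[z] : 0 < #|[set: G] :\ x :\ y|.
    move: n_ge3; rewrite -cardsT (cardsD1 x) inE (cardsD1 y) !inE.
    by case: (y != x) => /=; rewrite ?add0n ?add1n ?ltnS // => /ltnW.
  rewrite !inE => /and3P[zy zx _].
  have xz : adj x z by rewrite complete // eq_sym.
  exists (exist (fun d : G * G => adj d.1 d.2) (x, z) xz) => //.
  by rewrite -val_eqE /= xpair_eqE eqxx.
have := spherical_card_dart sph deg2; rewrite card_sig.
have card_adj : #|[pred d : G * G | adj d.1 d.2]| + #|G| = #|G| * #|G|.
  rewrite -card_prod -(cardC [pred d : G * G | adj d.1 d.2]); congr (_ + _).
  have diag_inj : injective (fun x : G => (x, x)) by move=> x y [].
  rewrite -(card_codom diag_inj); apply: eq_card => -[x y].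
  apply/codomP/idP => [[z [-> ->]]|]; first by rewrite !inE /= adj_irrefl.
  by rewrite !inE /=; case: (eqVneq x y) => [<- _|/complete->//]; exists x.
move: card_adj; move: #|[pred d | _]| #|G| => m n; clear; nia.
Qed.

End EmbeddedGraph.

(** * The bounds for the maximum partial-dual genus *)

Lemma edge_connected_dart lambda (G : sgraph) :
  0 < lambda -> edge_connected lambda G -> 1 < #|G| -> inhabited (dart G).
Proof.
move=> lambda_gt0 conn /card_gt1P[x [y [_ _ xy]]].
have yx : y \notin [set x] by rewrite inE eq_sym.
have /(leq_trans lambda_gt0)/card_gt0P[d] :=
  edge_connected_cut conn (set11 x) yx.
by rewrite inE => /and3P[d_adj _ _]; split; exists d.
Qed.

Lemma edge_connected_order lambda (G : sgraph) :
  edge_connected lambda G -> 1 < #|G| -> lambda < #|G|.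
Proof.
move=> conn n_gt1; have /card_gt1P[x [y [_ _ xy]]] := n_gt1.
have yx : y \notin [set x] by rewrite inE eq_sym.
rewrite -(prednK (ltnW n_gt1)) ltnS -(cardC1 x).
apply: leq_trans (edge_connected_cut conn (set11 x) yx) _.
apply: leq_trans (leq_imset_card (pair x) _); apply: subset_leq_card.
apply/subsetP=> -[u v]; rewrite !inE => /and3P[_ /eqP /= -> vx].
exact: imset_f.
Qed.

Lemma complete_isomorphic (G : sgraph) :
  (forall x y : G, x != y -> adj x y) -> isomorphic G (complete_graph #|G|).
Proof.
move=> complete; exists (fun x => enum_rank x : complete_graph #|G|).
  exists (fun i : 'I_#|G| => enum_val i); first exact: enum_rankK.
  exact: enum_valK.
move=> x y; rewrite /= /complete_adj (inj_eq enum_rank_inj).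
by case: (eqVneq x y) => [->|/complete->]; rewrite ?adj_irrefl.
Qed.

Lemma chromatic_number_clique (G : sgraph) :
  exists c : G -> 'I_(chromatic_number (complement G)),
    forall x y, x != y -> c x = c y -> adj x y.
Proof.
rewrite /chromatic_number; case: ex_minnP => k /existsP[c /forallP cP] _.
exists (fun x => c (x : complement G)) => x y xy cxy.
have /forallP/(_ y) := cP x; rewrite cxy eqxx /= implybF /compl_adj xy.
by rewrite negbK.
Qed.

Theorem theorem1p8 (lambda : nat) (G : sgraph) (r : {perm dart G}) :
  lambda \in [:: 1; 2; 3] ->
  edge_connected lambda G ->
  sphere_embedding r ->
  2 <= #|G| ->
  ~ isomorphic G (complete_graph 4) ->
  let n := #|G| in
  let chi := chromatic_number (complement G) in
  ((if lambda == 1%N then Num.max 0 (n%:Z - (3 * chi)%N%:Z)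
    else if lambda == 2%N then Num.max 1 (n%:Z - (3 * chi)%N%:Z + 1)
    else Num.max ((uphalf n)%:Z + 1) (n%:Z - ((3 * chi)%N %/ 2)%N%:Z + 1))
   <= (max_partial_dual_genus (embedded r))%:Z)%R.
Proof.
move=> lambda123 conn [rotr sph] n_ge2 notK4; cbv zeta.
set n := #|G|; set chi := chromatic_number _; set g := max_partial_dual_genus _.
have lambda_gt0 : 0 < lambda by move: lambda123; rewrite !inE => /or3P[]/eqP->.
have [d0] := edge_connected_dart lambda_gt0 conn n_ge2.
have lambda_n := edge_connected_order conn n_ge2.
have [rho rhoK] := max_genus_quotient rotr d0.
have [c c_clique] := chromatic_number_clique G.
have le6 := leq_card_reps6 rhoK c_clique.
have le_cross := leq_card_cross_pairs rhoK conn.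
have reps_gt0 : 0 < #|reps rho|.
  by apply/card_gt0P; exists (rho (val d0).1); apply: rho_reps.
have reps_n : #|reps rho| <= n by apply: leq_imset_card.
rewrite -/n -/g => genus_ge.
have chi_gt1 : lambda = 3 -> 1 < chi.
  move=> lambda3; rewrite ltnNge; apply/negP=> chi_le1; apply: notK4.
  have complete (x y : G) : x != y -> adj x y.
    move=> xy; apply: c_clique => //; apply/val_inj.
    have c0 z : c z = 0 :> nat.
      by have := leq_trans (ltn_ord (c z)) chi_le1; case: (val _).
    by rewrite /= !c0.
  have n_gt3 : 3 < n by rewrite -lambda3.
  suff n4 : n = 4 by rewrite -n4; apply: complete_isomorphic.
  apply/eqP; rewrite eqn_leq n_gt3 andbT.
  by apply: (spherical_complete_order rotr complete sph); apply: ltnW.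
have ge_chi : 2 + 2 * n <= 2 * g + 6 * chi.
  by move: genus_ge le6; rewrite -/chi; lia.
have ge_chi3 : lambda = 3 -> 2 + 2 * n <= 2 * g + 3 * chi.
  move=> lambda3.
  have conn3 : edge_connected 3 G by rewrite -lambda3.
  have := leq_card_reps3 rhoK c_clique conn3 (chi_gt1 lambda3).
  by move: genus_ge; rewrite -/chi; lia.
have ge_n : 2 + 2 * n + lambda * #|reps rho| <= 2 * g + 4 * #|reps rho|
    \/ 2 * n <= 2 * g + 2.
  have [p1|/le_cross cross] := leqP #|reps rho| 1.
    by right; lia.
  by left; lia.
move: lambda123; rewrite !inE => /or3P[]/eqP lambdaE; rewrite lambdaE /=.
- by lia.
- by move: ge_n; rewrite lambdaE; lia.
- by move: ge_n lambda_n (ge_chi3 lambdaE); rewrite -/n lambdaE; lia.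
Qed.
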